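(* Let $A$ be a $C^*$-algebra and let $\Phi$ be an involutory $*$-antiautomorphism of $A$. Then $A$ is exact if and only if $A_\Phi$ is exact.
   Context: All $C^*$-algebras are complex unless stated otherwise. An involutory $*$-antiautomorphism $\Phi$ of a $C^*$-algebra $A$ is a complex-linear $*$-preserving bijection with $\Phi(ab)=\Phi(b)\Phi(a)$ and $\Phi\circ\Phi=\mathrm{id}$. Put $A_\Phi=\{a\in A:\Phi(a)=a^*\}$, a real $*$-subalgebra with $A_\Phi\cap iA_\Phi=\{0\}$ and $A=A_\Phi+iA_\Phi$. $A\otimes_{\min}B$ is the completion of the algebraic tensor product $A\otimes_{\mathrm{alg}}B$ in the spatial (minimal) $C^*$-norm. For a $C^*$-algebra $B$, $A_\Phi\otimes_{\min}B$ is the closure in $A\otimes_{\min}B$ of the real-linear span $A_\Phi\otimes_{\mathrm{alg}}B$ of the elementary tensors $a\otimes b$ with $a\in A_\Phi$, $b\in B$. $A$ is exact if for every $C^*$-algebra $B$ and closed two-sided ideal $I$ of $B$, with inclusion $\imath:I\to B$ and quotient map $\pi:B\to B/I$, the sequence $0\to A\otimes_{\min}I\xrightarrow{\mathrm{id}_A\otimes\imath}A\otimes_{\min}B\xrightarrow{\mathrm{id}_A\otimes\pi}A\otimes_{\min}(B/I)\to0$ is exact. $A_\Phi$ is exact if for every such (complex) $C^*$-algebra $B$ and ideal $I$ the sequence $0\to A_\Phi\otimes_{\min}I\xrightarrow{\mathrm{id}_{A_\Phi}\otimes\imath}A_\Phi\otimes_{\min}B\xrightarrow{\mathrm{id}_{A_\Phi}\otimes\pi}A_\Phi\otimes_{\min}(B/I)\to0$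 is exact. *)

(* Defs.v *)
From HB Require Import structures.
From mathcomp Require Import all_boot all_order all_algebra complex.
From mathcomp Require Import all_classical all_reals all_analysis.

Set Implicit Arguments.
Unset Strict Implicit.
Unset Printing Implicit Defensive.

Import Order.TTheory GRing.Theory Num.Theory.
Import numFieldNormedType.Exports.

Local Open Scope classical_set_scope.
Local Open Scope ring_scope.

(* Complex C*-algebras, not assumed unital.  The norm of a normed module over
   R[i] takes its values in R[i]; norms are compared there, or in R through
   the real part. *)
HB.mixin Record isCStarAlgebra (R : realType) A
    of CompleteNormedModule R[i] A := {
  amul : A -> A -> A;
  astar : A -> A;
  amulA : associative amul;
  amulDl : left_distributive amul +%R;
  amulDr : right_distributive amul +%R;
  amulZl : forall (k : R[i]) (a b : A), amul (k *: a) b = k *: amul a b;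
  amulZr : forall (k : R[i]) (a b : A), amul a (k *: b) = k *: amul a b;
  astarK : involutive astar;
  astarD : {morph astar : a b / a + b};
  astarZ : forall (k : R[i]) (a : A), astar (k *: a) = k^* *: astar a;
  astarM : forall a b : A, astar (amul a b) = amul (astar b) (astar a);
  norm_amul : forall a b : A, `|amul a b| <= `|a| * `|b|;
  norm_astar_amul : forall a : A, `|amul (astar a) a| = `|a| ^+ 2
}.

#[short(type="cstarAlgType")]
HB.structure Definition CStarAlgebra (R : realType) :=
  {A of isCStarAlgebra R A & CompleteNormedModule R[i] A}.

Record star_hom (R : realType) (A B : cstarAlgType R) (f : A -> B) : Prop := {
  star_hom_linear : linear f;
  star_homM : forall a b : A, f (amul a b) = amul (f a) (f b);
  star_hom_star : forall a : A, f (astar a) = astar (f a)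
}.

Record involutory_star_antiautomorphism (R : realType) (A : cstarAlgType R)
    (Phi : A -> A) : Prop := {
  antiaut_linear : linear Phi;
  antiaut_star : forall a : A, Phi (astar a) = astar (Phi a);
  antiaut_bij : bijective Phi;
  antiautM : forall a b : A, Phi (amul a b) = amul (Phi b) (Phi a);
  antiautK : Phi \o Phi = id
}.

(* The real *-algebra A_Phi. *)
Definition real_subalgebra (R : realType) (A : cstarAlgType R)
  (Phi : A -> A) : set A := [set a | Phi a = astar a].

(* The inner product is linear in its first argument. *)
Record hilbertSpace (R : realType) := HilbertSpace {
  hilbert_sort :> completeNormedModType R[i];
  inner : {dot hilbert_sort for Num.conj};
  inner_norm : forall x : hilbert_sort, `|x| ^+ 2 = inner x x
}.

Record representation (R : realType) (A : cstarAlgType R) := Representation {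
  rep_space : hilbertSpace R;
  rep :> A -> {linear rep_space -> rep_space};
  rep_continuous : forall a : A, continuous (rep a);
  rep_linear : forall (k : R[i]) (a b : A) (x : rep_space),
    rep (k *: a + b) x = k *: rep a x + rep b x;
  repM : forall (a b : A) (x : rep_space), rep (amul a b) x = rep a (rep b x);
  rep_star : forall (a : A) (x y : rep_space),
    inner rep_space (rep a x) y = inner rep_space x (rep (astar a) y)
}.

(* Finite sums of elementary tensors are given by the lists of their terms.
   This is the squared norm of \sum_p p.1 (x) p.2 in the Hilbert space
   tensor product of H and K. *)
Definition hilbert_tensor_sqnorm (R : realType) (H K : hilbertSpace R)
    (z : seq (H * K)) : R :=
  complex.Re (\sum_(p <- z) \sum_(q <- z)
    inner H p.1 q.1 * inner K p.2 q.2).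

(* (\sum_x pi x.1 (x) sigma x.2) applied to \sum_p p.1 (x) p.2 *)
Definition tensor_action (R : realType) (A B : cstarAlgType R)
    (pi : representation A) (sigma : representation B)
    (u : seq (A * B)) (z : seq (rep_space pi * rep_space sigma)) :
    seq (rep_space pi * rep_space sigma) :=
  [seq (pi x.1 p.1, sigma x.2 p.2) | x <- u, p <- z].

(* Supremum, over all pairs of representations, of the operator norm of
   (pi (x) sigma)(\sum_x x.1 (x) x.2); the operator norm is computed on the
   algebraic tensor product of the two Hilbert spaces, which is dense. *)
Definition spatial_norm (R : realType) (A B : cstarAlgType R)
    (u : seq (A * B)) : \bar R :=
  ereal_sup [set e | exists (pi : representation A) (sigma : representation B)
    (z : seq (rep_space pi * rep_space sigma)),
    hilbert_tensor_sqnorm z <= 1 /\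
    e = (Num.sqrt (hilbert_tensor_sqnorm (tensor_action u z)))%:E].

(* Linear combinations of elements of S with coefficients in K. *)
Definition lin_span (R : realType) (T : cstarAlgType R) (K : set R[i])
    (S : set T) : set T :=
  [set x | exists u : seq (R[i] * T),
    (forall p, p \in u -> K p.1 /\ S p.2) /\ x = \sum_(p <- u) p.1 *: p.2].

Definition real_scalars (R : realType) : set R[i] :=
  [set (r%:C)%C | r in [set: R]].

(* The completion of the algebraic tensor product of A and B in the spatial
   norm.  As for any completion, it is determined up to a unique isometric
   isomorphism compatible with the elementary tensors. *)
Record minTensor (R : realType) (A B : cstarAlgType R) := MinTensor {
  tensor_sort :> cstarAlgType R;
  tens : A -> B -> tensor_sort;
  tens_linearl : forall b : B, linear (tens ^~ b);
  tens_linearr : forall a : A, linear (tens a);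
  tensM : forall (a a' : A) (b b' : B),
    amul (tens a b) (tens a' b') = tens (amul a a') (amul b b');
  tens_star : forall (a : A) (b : B),
    astar (tens a b) = tens (astar a) (astar b);
  tens_norm : forall u : seq (A * B),
    (complex.Re `|\sum_(x <- u) tens x.1 x.2|)%:E = spatial_norm u;
  tens_dense : closure (lin_span [set: R[i]]
    [set tens a b | a in [set: A] & b in [set: B]]) = [set: tensor_sort]
}.

(* S (x)_min B for a real subspace S of A, inside A (x)_min B. *)
Definition real_min_tensor (R : realType) (A B : cstarAlgType R)
    (T : minTensor A B) (S : set A) : set T :=
  closure (lin_span (@real_scalars R)
    [set tens T a b | a in S & b in [set: B]]).

(* id_A (x) h: the continuous extension of a (x) b |-> a (x) h b. *)
Record id_tensor (R : realType) (A B C : cstarAlgType R)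
    (TB : minTensor A B) (TC : minTensor A C) (h : B -> C)
    (f : TB -> TC) : Prop := {
  id_tensor_linear : linear f;
  id_tensor_continuous : continuous f;
  id_tensorE : forall (a : A) (b : B), f (tens TB a b) = tens TC a (h b)
}.

Record closed_ideal (R : realType) (B : cstarAlgType R) (I : set B) : Prop := {
  ideal_closed : closed I;
  ideal0 : I 0;
  idealD : forall a b : B, I a -> I b -> I (a + b);
  idealZ : forall (k : R[i]) (a : B), I a -> I (k *: a);
  idealMl : forall a b : B, I b -> I (amul a b);
  idealMr : forall a b : B, I a -> I (amul a b)
}.

(* I with the C*-algebra structure inherited from B. *)
Record idealAlg (R : realType) (B : cstarAlgType R) (I : set B) := IdealAlg {
  ideal_sort :> cstarAlgType R;
  ideal_incl : ideal_sort -> B;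
  ideal_incl_hom : star_hom ideal_incl;
  ideal_incl_norm : forall x : ideal_sort, `|ideal_incl x| = `|x|;
  ideal_incl_range : range ideal_incl = I
}.

(* B/I with the quotient norm. *)
Record quotientAlg (R : realType) (B : cstarAlgType R) (I : set B) :=
  QuotientAlg {
  quotient_sort :> cstarAlgType R;
  quotient_proj : B -> quotient_sort;
  quotient_proj_hom : star_hom quotient_proj;
  quotient_proj_surj : range quotient_proj = [set: quotient_sort];
  quotient_proj_ker : quotient_proj @^-1` [set 0] = I;
  quotient_proj_norm : forall b : B,
    complex.Re `|quotient_proj b| = inf [set complex.Re `|b + i| | i in I]
}.

(* Exactness of 0 -> X -> Y -> Z -> 0, where X, Y and Z are subspaces and the
   maps are the restrictions of f and g. *)
Record short_exact (R : realType) (T1 T2 T3 : cstarAlgType R)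
    (X : set T1) (Y : set T2) (Z : set T3) (f : T1 -> T2) (g : T2 -> T3) :
    Prop := {
  short_exact_fun1 : forall x, X x -> Y (f x);
  short_exact_fun2 : forall y, Y y -> Z (g y);
  short_exact_inj : set_inj X f;
  short_exact_mid : f @` X = [set y | Y y /\ g y = 0];
  short_exact_surj : g @` Y = Z
}.

(* The objects and maps of the sequence
   A (x) I -> A (x) B -> A (x) B/I attached to a closed ideal I of B. *)
Record tensorSequence (R : realType) (A : cstarAlgType R) := TensorSequence {
  seq_alg : cstarAlgType R;
  seq_ideal : set seq_alg;
  seq_idealP : closed_ideal seq_ideal;
  seq_sub : idealAlg seq_ideal;
  seq_quo : quotientAlg seq_ideal;
  seq_T1 : minTensor A seq_sub;
  seq_T2 : minTensor A seq_alg;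
  seq_T3 : minTensor A seq_quo;
  seq_incl : seq_T1 -> seq_T2;
  seq_inclP : id_tensor (@ideal_incl _ _ _ seq_sub) seq_incl;
  seq_proj : seq_T2 -> seq_T3;
  seq_projP : id_tensor (@quotient_proj _ _ _ seq_quo) seq_proj
}.

Definition exact_cstar (R : realType) (A : cstarAlgType R) : Prop :=
  forall s : tensorSequence A,
    short_exact [set: seq_T1 s] [set: seq_T2 s] [set: seq_T3 s]
      (@seq_incl _ _ s) (@seq_proj _ _ s).

Definition exact_real (R : realType) (A : cstarAlgType R) (S : set A) : Prop :=
  forall s : tensorSequence A,
    short_exact (real_min_tensor (T := seq_T1 s) S)
      (real_min_tensor (T := seq_T2 s) S) (real_min_tensor (T := seq_T3 s) S)
      (@seq_incl _ _ s) (@seq_proj _ _ s).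

(* Main.v *)
(** Since B is a complex algebra, a (x) ib = i (a (x) b), so A = A_Phi + i A_Phi
    makes the real span of the elementary tensors a (x) b with a in A_Phi equal
    to the whole algebraic tensor product.  Hence A_Phi (x)_min B = A (x)_min B,
    and the two exactness conditions concern the same sequences. *)
Require Import Defs.
From mathcomp Require Import all_boot all_order all_algebra.
From mathcomp Require Import all_classical all_reals all_analysis.
From mathcomp Require Import complex.

Import GRing.Theory Num.Theory.
Local Open Scope classical_set_scope.
Local Open Scope ring_scope.

(** The map sending [a] to [Phi (astar a)] is a conjugate-linear involution with fixed-point set
    A_Phi; [x] and [y] are the real and imaginary parts of [a] with respect to it. *)
Lemma real_subalgebra_decomposition (R : realType) (A : cstarAlgType R)
    (Phi : A -> A) (hPhi : involutory_star_antiautomorphism Phi) (a : A) :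
  exists2 x, real_subalgebra Phi x &
  exists2 y, real_subalgebra Phi y & a = x + 'i%C *: y.
Proof.
have PhiL k x y : Phi (k *: x + y) = k *: Phi x + Phi y.
  exact: (antiaut_linear hPhi).
have PhiK x : Phi (Phi x) = x by have /(congr1 (@^~ x)) := antiautK hPhi.
have Phi0 : Phi 0 = 0.
  by apply: (addrI (Phi 0)); have := PhiL 1 0 0; rewrite !scale1r !addr0.
have PhiZ k x : Phi (k *: x) = k *: Phi x by have := PhiL k x 0; rewrite Phi0 !addr0.
have PhiD x y : Phi (x + y) = Phi x + Phi y.
  by have := PhiL 1 x y; rewrite !scale1r.
pose b := Phi (astar a).
have Phib : Phi b = astar a by rewrite /b PhiK.
have starb : astar b = Phi a by rewrite /b -(antiaut_star hPhi) astarK.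
pose h : R[i] := 2^-1.
have hC : h^*%R = h by apply: conj_Creal; rewrite realV realn.
have iC : ('i%C : R[i])^*%R = - 'i%C by apply/eqP; rewrite eq_complex /= oppr0 !eqxx.
have ii : ('i%C : R[i]) * 'i%C = -1 by rewrite -expr2 sqr_i.
exists (h *: (a + b)).
  by rewrite /real_subalgebra /= PhiZ PhiD Phib astarZ astarD starb hC [in RHS]addrC.
(* This is (a - b)/(2i). The involution swaps [a] and [b], hence negates a - b, and conjugating the
   scalar restores the sign. *)
exists ((- 'i%C * h) *: (a + (-1) *: b)).
  rewrite /real_subalgebra /= PhiZ PhiD PhiZ Phib astarZ astarD astarZ starb.
  rewrite !rmorphM !rmorphN rmorph1 /= hC iC opprK mulNr scaleNr -scalerN.
  by rewrite !scaleN1r opprB.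
rewrite scalerA mulrA mulrN ii opprK mul1r -scalerDr scaleN1r.
by rewrite addrACA subrr addr0 -mulr2n -scaler_nat scalerA mulVf ?scale1r ?pnatr_eq0.
Qed.

Lemma real_min_tensorT (R : realType) (A B : cstarAlgType R) (T : minTensor A B)
    (Phi : A -> A) (hPhi : involutory_star_antiautomorphism Phi) :
  real_min_tensor (T := T) (real_subalgebra Phi) = [set: T].
Proof.
(* Elementary tensors have dense complex span, so it suffices to place that span inside the real one
   before taking closures. *)
rewrite -subTset -(tens_dense T); apply: closure_subset => _ [u [uS ->]].
elim: u uS => [|[k t] u IH] uS.
  by rewrite big_nil; exists [::]; split=> //; rewrite big_nil.
have [|v [vS vE]] := IH.
  by move=> p pu; apply: uS; rewrite inE pu orbT.
have [_ [a _ [b _ /= tE]]] := uS (k, t) (mem_head _ _).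
have [x xS [y yS aE]] := real_subalgebra_decomposition _ _ _ hPhi a.
(* The complex scalars [k] and ['i * k] are absorbed into the factor from [B], so each term of [u]
   becomes two terms with the real coefficient 1. *)
exists [:: (1, tens T x (k *: b)), (1, tens T y (('i%C * k) *: b)) & v]; split.
  move=> p; rewrite !inE => /or3P[/eqP->|/eqP->|/vS//]; split=> /=;
    by [exists 1 | exists x => //; exists (k *: b) | exists y => //; exists (('i%C * k) *: b)].
have tZDl l c d e : tens T (l *: c + d) e = l *: tens T c e + tens T d e.
  exact: (tens_linearl T).
have tr0 c : tens T c 0 = 0.
  apply: (addrI (tens T c 0)).
  by have := tens_linearr T c 1 0 0; rewrite !scale1r !addr0.
have tZr c l d : tens T c (l *: d) = l *: tens T c d.
  by have := tens_linearr T c l d 0; rewrite tr0 !addr0.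
rewrite !big_cons /= vE addrA; congr (_ + _).
by rewrite !scale1r !tZr -tE aE [x + _]addrC tZDl scalerDr scalerA [k * _]mulrC addrC.
Qed.

Theorem theorem3p1 (R : realType) (A : cstarAlgType R) (Phi : A -> A)
    (hPhi : involutory_star_antiautomorphism Phi) :
  exact_cstar A <-> exact_real (real_subalgebra Phi).
Proof.
(* The rewriting turns all three real tensor products into full sets, with the maps unchanged. *)
by split=> exA s; have := exA s; rewrite !real_min_tensorT.
Qed.
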